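(* Let $P\subseteq[0,1]^d$ be a convex set and let $\bar x\in P$ be such that $\bar x^{(j)}\in P$ and $\bar x^{(j)}+e_j\in P$ for every $j$ with $0<\bar x_j<1$. Then $\bar x\in N_+(P)$.
   Context: For $x\in\mathbb{R}^d$ and $j\in\{1,\dots,d\}$, $x^{(j)}=x-x_je_j$ (the vector $x$ with its $j$-th coordinate set to $0$); $e_j$ is the $j$-th unit vector. Vectors in $\mathbb{R}^{d+1}$ have coordinates indexed $0,\dots,d$ and are written $(x_0,x)$. $Q\subseteq\mathbb{R}^{d+1}$ is the convex cone generated by all $(1,x)$ with $x\in\{0,1\}^d$; for a convex cone $C$, $C^*=\{s:s^Tx\ge0\ \forall x\in C\}$. For a convex cone $K\subseteq Q$, $M_+(K)$ is the set of real symmetric positive semidefinite $(d+1)\times(d+1)$ matrices $Y$ with $Ye_0=\mathrm{diag}(Y)$ and $u^TYv\ge0$ for all $u\in Q^*$, $v\in K^*$, and $N_+(K)=\{\mathrm{diag}(Y):Y\in M_+(K)\}$. For a convex set $P\subseteq[0,1]^d$, let $K_P=\{(\lambda,\lambda x):x\in P,\lambda\ge0\}$ and $N_+(P)=\{x\in\mathbb{R}^d:(1,x)\in N_+(K_P)\}$. *)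

(* Defs.v *)
(* The reals are an abstract R : realType, R^d is
   'cV[R]_d (coordinates indexed from 0) and R^(d+1) is 'cV[R]_(1 + d). *)
From HB Require Import structures.
From mathcomp Require Import all_boot all_order all_algebra.
From mathcomp Require Import boolp classical_sets reals convex.

Set Implicit Arguments.
Unset Strict Implicit.
Unset Printing Implicit Defensive.

Import Order.TTheory GRing.Theory Num.Theory.

Local Open Scope classical_set_scope.
Local Open Scope ring_scope.

Section Defs.
Variable R : realType.

Section FixedDimension.
Variable n : nat.

Definition unit_vec (j : 'I_n) : 'cV[R]_n := delta_mx j ord0.

(* x^(j) *)
Definition zero_coord (x : 'cV[R]_n) (j : 'I_n) : 'cV[R]_n :=
  x - x j ord0 *: unit_vec j.

Definition unit_cube : set 'cV[R]_n :=
  [set x | forall i, 0 <= x i ord0 <= 1].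

Definition cube_vertices : set 'cV[R]_n :=
  [set x | forall i, x i ord0 = 0 \/ x i ord0 = 1].

(* The convex cone generated by A; the empty combination (k = 0) makes it
   contain 0. *)
Definition cone_hull (A : set 'cV[R]_n) : set 'cV[R]_n :=
  [set y | exists (k : nat) (c : 'I_k -> R) (a : 'I_k -> 'cV[R]_n),
     [/\ forall i, 0 <= c i, forall i, A (a i) & y = \sum_i c i *: a i]].

Definition dual_cone (C : set 'cV[R]_n) : set 'cV[R]_n :=
  [set s | forall x, C x -> 0 <= (s^T *m x) ord0 ord0].

Definition psd (Y : 'M[R]_n) : Prop :=
  Y^T = Y /\ forall z : 'cV[R]_n, 0 <= (z^T *m Y *m z) ord0 ord0.

(* The diagonal of Y as a column vector (not to be confused with diag_mx,
   which maps a vector to a diagonal matrix). *)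
Definition diag_vec (Y : 'M[R]_n) : 'cV[R]_n := \col_i Y i i.

End FixedDimension.

Section Lifting.
Variable d : nat.

(* The vector (l, x) of R^(d+1). *)
Definition lift_vec (l : R) (x : 'cV[R]_d) : 'cV[R]_(1 + d) := col_mx l%:M x.

Definition Qcone : set 'cV[R]_(1 + d) :=
  cone_hull [set lift_vec 1 x | x in @cube_vertices d].

(* Defined for an arbitrary set K; used only for convex cones K `<=` Qcone. *)
Definition M_plus (K : set 'cV[R]_(1 + d)) : set 'M[R]_(1 + d) :=
  [set Y | [/\ psd Y,
               Y *m unit_vec (ord0 : 'I_(1 + d)) = diag_vec Y
             & forall u v, dual_cone Qcone u -> dual_cone K v ->
                 0 <= (u^T *m Y *m v) ord0 ord0]].

Definition N_plus_cone (K : set 'cV[R]_(1 + d)) : set 'cV[R]_(1 + d) :=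
  [set diag_vec Y | Y in M_plus K].

Definition cone_of (P : set 'cV[R]_d) : set 'cV[R]_(1 + d) :=
  [set y | exists (l : R) (x : 'cV[R]_d),
     [/\ 0 <= l, P x & y = lift_vec l (l *: x)]].

Definition N_plus (P : set 'cV[R]_d) : set 'cV[R]_d :=
  [set x | N_plus_cone (cone_of P) (lift_vec 1 x)].

End Lifting.
End Defs.

(* Main.v *)
Require Import Defs.
From HB Require Import structures.
From mathcomp Require Import all_boot all_order all_algebra.
From mathcomp Require Import ring lra.
From mathcomp Require Import boolp classical_sets reals convex.

Set Implicit Arguments.
Unset Strict Implicit.
Unset Printing Implicit Defensive.

Import Order.TTheory GRing.Theory Num.Theory.

Local Open Scope classical_set_scope.
Local Open Scope ring_scope.

(* Take Y = (1, x)(1, x)^T + diag(0, (x_j (1 - x_j))_j).  Its column j is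
   x_j (1, x^(j) + e_j), and column 0 minus column j is (1 - x_j) (1, x^(j)), so
   both lie in K_P.  Since Q^* is generated by the vectors e_j, e_0 - e_j and
   e_0, this gives u^T Y v >= 0 for u in Q^* and v in K_P^*. *)

Lemma mulmx_tr_liftE (R : realType) (d : nat) (u : 'cV[R]_(1 + d)) (l : R)
    (x : 'cV[R]_d) :
  (u^T *m lift_vec l x) ord0 ord0 =
    u (lshift d ord0) ord0 * l + \sum_j u (rshift 1 j) ord0 * x j ord0.
Proof.
rewrite mxE big_split_ord big_ord1 /= !mxE.
rewrite (unsplitK (inl _)) /= mxE mulr1n; congr (_ + _).
by apply: eq_bigr => j _; rewrite !mxE (unsplitK (inr _)).
Qed.

Lemma dual_cone_of_ge0 (R : realType) (d : nat) (P : set 'cV[R]_d)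
    (v : 'cV[R]_(1 + d)) (y : 'cV[R]_d) :
  dual_cone (cone_of P) v -> P y -> 0 <= (v^T *m lift_vec 1 y) ord0 ord0.
Proof.
by move=> dual_v Py; apply: dual_v; exists 1, y; split; rewrite ?scale1r.
Qed.

(* Evaluate u at the vertex (1, x) where x is the indicator of u_j < 0. *)
Lemma dual_Qcone_ge0 (R : realType) (d : nat) (u : 'cV[R]_(1 + d)) :
  dual_cone (@Qcone R d) u ->
  0 <= u (lshift d ord0) ord0 + \sum_j Num.min (u (rshift 1 j) ord0) 0.
Proof.
pose x : 'cV[R]_d := \col_j (u (rshift 1 j) ord0 < 0)%R%:R.
move=> /(_ (lift_vec 1 x)); rewrite mulmx_tr_liftE mulr1.
rewrite (eq_bigr (fun j => Num.min (u (rshift 1 j) ord0) 0)); last first.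
  by move=> j _; rewrite mxE minEle; case: ltrgt0P => [||->]; rewrite ?mulr0 ?mulr1.
apply; exists 1%N, (fun=> 1), (fun=> lift_vec 1 x); split=> //.
- move=> _; exists x => // j; rewrite mxE.
  by case: ltP => _; [right | left].
- by rewrite big_ord1 scale1r.
Qed.

Definition lift_mx (R : realType) (d : nat) (x : 'cV[R]_d) : 'M[R]_(1 + d) :=
  lift_vec 1 x *m (lift_vec 1 x)^T +
  diag_mx (row_mx 0 (\row_j (x j ord0 * (1 - x j ord0)))).

(** The rank-one part gives the product and the diagonal part the sum. Taking [u] = [v] yields
    positive semidefiniteness; general [u] and [v] serve the dual-cone condition. *)
Lemma lift_mxE (R : realType) (d : nat) (x : 'cV[R]_d)
    (u v : 'cV[R]_(1 + d)) :
  (u^T *m lift_mx x *m v) ord0 ord0 =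
    (u^T *m lift_vec 1 x) ord0 ord0 * (v^T *m lift_vec 1 x) ord0 ord0 +
    \sum_j x j ord0 * (1 - x j ord0) *
      (u (rshift 1 j) ord0 * v (rshift 1 j) ord0).
Proof.
rewrite /lift_mx mulmxDr mulmxDl mulmxA -mulmxA mxE; congr (_ + _).
  rewrite [LHS]mxE big_ord1; congr (_ * _).
  by rewrite -[in RHS](trmxK (lift_vec 1 x)) -trmx_mul [RHS]mxE.
rewrite mul_mx_diag mxE big_split_ord big_ord1 /= !mxE (unsplitK (inl _)).
rewrite !mxE mulr0 mul0r add0r.
by apply: eq_bigr => j _; rewrite !mxE (unsplitK (inr _)) !mxE; ring.
Qed.

Lemma lift_mx_psd (R : realType) (d : nat) (x : 'cV[R]_d) :
  unit_cube x -> psd (lift_mx x).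
Proof.
move=> cube_x; split=> [|z].
  by rewrite /lift_mx linearD /= trmx_mul trmxK tr_diag_mx.
rewrite lift_mxE addr_ge0 -?expr2 ?sqr_ge0 // sumr_ge0 // => j _.
have /andP[x_ge0 x_le1] := cube_x j.
by rewrite -expr2 mulr_ge0 ?sqr_ge0 // mulr_ge0 ?subr_ge0.
Qed.

(** The diagonal correction is chosen for this: x_j^2 + x_j (1 - x_j) = x_j. *)
Lemma lift_mx_diag (R : realType) (d : nat) (x : 'cV[R]_d) :
  diag_vec (lift_mx x) = lift_vec 1 x.
Proof.
apply/colP => i; rewrite !mxE big_ord1 !mxE eqxx mulr1n -[i]splitK.
case: (split i) => [k|j]; rewrite !unsplitK !mxE.
  by rewrite (ord1 k) mulr1n; ring.
ring.
Qed.

(** The correction vanishes in column 0, which is thus that of the rank-one part. *)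
Lemma lift_mx_col0 (R : realType) (d : nat) (x : 'cV[R]_d) :
  lift_mx x *m unit_vec R (ord0 : 'I_(1 + d)) = lift_vec 1 x.
Proof.
rewrite -colE; apply/colP => i; rewrite mxE !mxE big_ord1 !mxE.
have -> : (ord0 : 'I_(1 + d)) = lshift d ord0 by apply: val_inj.
rewrite (unsplitK (inl _)) mxE -[i]splitK.
case: (split i) => [k|j]; rewrite !unsplitK !mxE ?eq_rlshift ?mulr0n.
  by rewrite (ord1 k) !eqxx mul0rn !mulr1n; ring.
by rewrite eqxx mulr1n; ring.
Qed.

(** Meant for the two face points, which are shifts of x along e_j: x^(j) = x - x_j e_j and x^(j) +
    e_j = x + (1 - x_j) e_j. *)
Lemma mulmx_tr_lift_shift (R : realType) (d : nat) (v : 'cV[R]_(1 + d))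
    (x : 'cV[R]_d) (c : R) (j : 'I_d) :
  (v^T *m lift_vec 1 (x + c *: unit_vec R j)) ord0 ord0 =
    (v^T *m lift_vec 1 x) ord0 ord0 + c * v (rshift 1 j) ord0.
Proof.
rewrite !mulmx_tr_liftE -[RHS]addrA; congr (_ + _).
rewrite (bigD1 j) //= [in RHS](bigD1 j) //= !mxE !eqxx.
rewrite (eq_bigr (fun i => v (rshift 1 i) ord0 * x i ord0)).
  by rewrite /=; ring.
by move=> i /negPf ij; rewrite !mxE ij /=; ring.
Qed.

Theorem theorem4p1 (R : realType) (d : nat) (P : set 'cV[R]_d)
    (xbar : 'cV[R]_d)
    (convP : convex_set P)
    (P_cube : P `<=` @unit_cube R d)
    (P_xbar : P xbar)
    (faces : forall j : 'I_d, 0 < xbar j ord0 < 1 ->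
       P (zero_coord xbar j) /\ P (zero_coord xbar j + unit_vec R j)) :
  N_plus P xbar.
Proof.
exists (lift_mx xbar); last exact: lift_mx_diag.
have cube_x := P_cube _ P_xbar.
split; first exact: lift_mx_psd.
  by rewrite lift_mx_col0 lift_mx_diag.
move=> u v /dual_Qcone_ge0 u_ge0 dual_v; rewrite lift_mxE mulmx_tr_liftE mulr1.
have a_ge0 := dual_cone_of_ge0 dual_v P_xbar.
set a := (v^T *m _) ord0 ord0 in a_ge0 *.
(* These are v^T applied to column j of Y and to column 0 minus column j. *)
have face_ge0 j : 0 <= xbar j ord0 * (a + (1 - xbar j ord0) * v (rshift 1 j) ord0)
    /\ 0 <= (1 - xbar j ord0) * (a - xbar j ord0 * v (rshift 1 j) ord0).
  have /andP[x_ge0 x_le1] := cube_x j.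
  (* At x_j = 0 or 1 [faces] gives nothing, but one quantity vanishes and the other equals [a]. *)
  have [x0|x_neq0] := eqVneq (xbar j ord0) 0; first by rewrite x0; lra.
  have [x1|x_neq1] := eqVneq (xbar j ord0) 1; first by rewrite x1; lra.
  have [|Pj0 Pj1] := faces j; first by rewrite lt0r x_neq0 x_ge0 lt_neqAle x_neq1.
  split; apply: mulr_ge0; rewrite ?[0 <= 1 - _]subr_ge0 //.
    rewrite -mulmx_tr_lift_shift; apply: dual_cone_of_ge0 dual_v _.
    by rewrite scalerBl scale1r addrA addrAC.
  rewrite -mulNr -mulmx_tr_lift_shift scaleNr.
  exact: dual_cone_of_ge0 dual_v Pj0.
rewrite mulrDl mulr_suml -addrA -big_split /=.
(* Split u as (u_0 + sum_j min(u_j, 0)) e_0 plus |u_j| times e_j if u_j > 0, or e_0 - e_j if u_j <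
   0. The middle term is the share of e_0, since v^T Y e_0 = [a]. *)
apply: le_trans (_ : 0 <= (u (lshift d ord0) ord0 +
  \sum_j Num.min (u (rshift 1 j) ord0) 0) * a) _; first exact: mulr_ge0.
rewrite mulrDl mulr_suml lerD2l; apply: ler_sum => j _.
have [face1 face0] := face_ge0 j.
(* The gap between the two j-th terms is -u_j times the [face0] quantity, respectively u_j times the
   [face1] one. *)
case: (leP (u (rshift 1 j) ord0) 0) => [u_le0 | /ltW u_ge0j].
  by rewrite -oppr_ge0 in u_le0; have := mulr_ge0 u_le0 face0; lra.
by have := mulr_ge0 u_ge0j face1; lra.
Qed.
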